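(* Let $G$ be a group with a presentation $\langle S\mid R\rangle$ such that $R$ consists only of relations of the form $wsw^{-1}=t$ for some $s,t\in S$ and $w\in G$. Then $$\operatorname{Env}(\mathcal{D}(S^G))\cong G.$$
   Context: A quandle is a non-empty set $Q$ with a binary operation $*$ such that: (i) $x*x=x$ for all $x$; (ii) for all $x,y\in Q$ there is a unique $z\in Q$ with $x=z*y$; (iii) $(x*y)*z=(x*z)*(y*z)$ for all $x,y,z$. For a group $G$ and a non-empty subset $A\subseteq G$, let $A^G$ be the set of all conjugates in $G$ of elements of $A$. The Dehn quandle $\mathcal{D}(A^G)$ is the set $A^G$ with the operation $x*y=yxy^{-1}$. The enveloping group $\operatorname{Env}(Q)$ of a quandle $Q$ is the group with generators $\{e_x\mid x\in Q\}$ and defining relations $e_{x*y}=e_ye_xe_y^{-1}$ for all $x,y\in Q$. In a relation $wsw^{-1}=t$ of the presentation, $w$ is given by a word in $S\cup S^{-1}$. *)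

(* Defs.v *)
From HB Require Import structures.
From mathcomp Require Import all_boot.
From mathcomp Require Import generic_quotient monoid boolp classical_sets.

Set Implicit Arguments.
Unset Strict Implicit.
Unset Printing Implicit Defensive.

Import Algebra.

Local Open Scope classical_set_scope.
Local Open Scope group_scope.

(* Words in X and its formal inverses: (x, false) is the letter x and
   (x, true) is the letter x^-1. *)
Definition word (X : Type) : Type := seq (X * bool).

Definition letter (X : Type) (x : X) : word X := [:: (x, false)].

Definition winv (X : Type) (w : word X) : word X :=
  rev [seq (a.1, ~~ a.2) | a <- w].

Definition relation (X : Type) : Type := (word X * word X)%type.

(* The congruence on words generated by the relations u = v, for (u, v) in R,
   together with the free cancellations x x^-1 = x^-1 x = 1. *)
Inductive pres_eq (X : Type) (R : set (relation X)) : word X -> word X -> Prop :=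
| pres_rel u v : R (u, v) -> pres_eq R u v
| pres_cancel x b : pres_eq R [:: (x, b); (x, ~~ b)] [::]
| pres_cat u u' v v' :
    pres_eq R u u' -> pres_eq R v v' -> pres_eq R (u ++ v) (u' ++ v')
| pres_refl u : pres_eq R u u
| pres_sym u v : pres_eq R u v -> pres_eq R v u
| pres_trans u v w : pres_eq R u v -> pres_eq R v w -> pres_eq R u w.

Section PresentedGroup.
Context (X : Type) (R : set (relation X)).

Definition pres_eqb (u v : {classic word X}) : bool := `[< pres_eq R u v >].

Lemma pres_eqb_equiv : equiv_class_of pres_eqb.
Proof.
split=> [u|u v|v u w].
- exact/asboolP/pres_refl.
- by apply/asboolP/asboolP; exact: pres_sym.
- by move=> /asboolP uv /asboolP vw; apply/asboolP; exact: pres_trans vw.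
Qed.

Canonical pres_equiv_rel := EquivRelPack pres_eqb_equiv.

(* The group < X | R >. *)
Definition pres_group : Type := {eq_quot pres_equiv_rel}%qT.
HB.instance Definition _ := Choice.on pres_group.
HB.instance Definition _ := EqQuotient.on pres_group.

Definition pres_class (w : word X) : pres_group :=
  \pi_pres_group%qT (w : {classic word X}).

Definition pres_gen (x : X) : pres_group := pres_class (letter x).

Lemma pres_classP u v : pres_class u = pres_class v <-> pres_eq R u v.
Proof.
split=> [/eqquotP /asboolP //|uv].
by apply/eqquotP/asboolP.
Qed.

Lemma pres_class_surj (g : pres_group) : exists w, g = pres_class w.
Proof. by exists (repr g); rewrite /pres_class reprK. Qed.

Definition pres_one : pres_group := pres_class [::].

Definition pres_mul (g h : pres_group) : pres_group :=
  pres_class ((repr g : word X) ++ (repr h : word X)).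

Definition pres_inv (g : pres_group) : pres_group :=
  pres_class (winv (repr g : word X)).

Lemma repr_class u : pres_eq R (repr (pres_class u) : word X) u.
Proof. by apply/pres_classP; rewrite /pres_class reprK. Qed.

Lemma pres_classM u v :
  pres_mul (pres_class u) (pres_class v) = pres_class (u ++ v).
Proof. by apply/pres_classP; apply: pres_cat; exact: repr_class. Qed.

Lemma winv_cons a (w : word X) : winv (a :: w) = winv w ++ [:: (a.1, ~~ a.2)].
Proof. by rewrite /winv /= rev_cons cats1. Qed.

Lemma pres_eq_mulV w : pres_eq R (w ++ winv w) [::].
Proof.
elim: w => [|[x b] w IH]; first exact: pres_refl.
rewrite winv_cons catA -cat1s -!catA [w ++ _ ++ _]catA.
apply: pres_trans (pres_cancel R x b).
rewrite -[X in pres_eq _ _ X]/([:: (x, b)] ++ [::] ++ [:: (x, ~~ b)]).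
apply: pres_cat; first exact: pres_refl.
by apply: pres_cat IH _; exact: pres_refl.
Qed.

Lemma winvK : involutive (@winv X).
Proof.
move=> w; rewrite /winv map_rev revK -map_comp -[RHS]map_id.
by apply: eq_map => -[x b] /=; rewrite negbK.
Qed.

Lemma pres_eq_mulVw w : pres_eq R (winv w ++ w) [::].
Proof. by rewrite -{2}[w]winvK; exact: pres_eq_mulV. Qed.

Lemma pres_mulA : associative pres_mul.
Proof.
move=> g h k; have [u ->] := pres_class_surj g.
have [v ->] := pres_class_surj h; have [w ->] := pres_class_surj k.
by rewrite !pres_classM catA.
Qed.

Lemma pres_mul1 : left_id pres_one pres_mul.
Proof. by move=> g; have [u ->] := pres_class_surj g; rewrite pres_classM. Qed.

Lemma pres_mulg1 : right_id pres_one pres_mul.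
Proof.
by move=> g; have [u ->] := pres_class_surj g; rewrite pres_classM cats0.
Qed.

Lemma pres_mulVg : left_inverse pres_one pres_inv pres_mul.
Proof.
move=> g; rewrite -{2}[g]reprK -/(pres_class _) pres_classM.
exact/pres_classP/pres_eq_mulVw.
Qed.

Lemma pres_mulgV : right_inverse pres_one pres_inv pres_mul.
Proof.
move=> g; rewrite -{1}[g]reprK -/(pres_class _) pres_classM.
exact/pres_classP/pres_eq_mulV.
Qed.

HB.instance Definition _ := isGroup.Build pres_group
  pres_mulA pres_mul1 pres_mulg1 pres_mulVg pres_mulgV.

End PresentedGroup.

Definition isomorphic (G H : groupType) : Prop :=
  exists f : UMagmaMorphism.type G H, bijective f.

(* G has the presentation < S | R >, the symbol s in S standing for the
   element iota s of G.  The map iota is not required to be injective, since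
   the relations may identify two generators. *)
Definition has_presentation (G : groupType) (S : Type) (iota : S -> G)
    (R : set (relation S)) : Prop :=
  exists f : UMagmaMorphism.type (pres_group R) G,
    bijective f /\ forall s, f (pres_gen R s) = iota s.

(* r is a relation w s w^-1 = t. *)
Definition conj_relation (S : Type) (r : relation S) : Prop :=
  exists (w : word S) (s t : S), r = (w ++ letter s ++ winv w, letter t).

HB.mixin Record isQuandle (Q : Type) := {
  qop : Q -> Q -> Q;
  quandle_inhabited : inhabited Q;
  qopxx : forall x, qop x x = x;
  qop_div : forall x y, exists! z, x = qop z y;
  qopD : forall x y z, qop (qop x y) z = qop (qop x z) (qop y z)
}.

#[short(type="quandleType")]
HB.structure Definition Quandle := {Q of isQuandle Q}.

(* e_(x*y) = e_y e_x e_y^-1 *)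
Definition env_relations (Q : quandleType) : set (relation Q) :=
  [set r | exists x y : Q,
     r = (letter (qop x y), letter y ++ letter x ++ winv (letter y))].

Definition Env (Q : quandleType) : groupType := pres_group (@env_relations Q).

Definition conjugates (G : groupType) (A : set G) : set G :=
  [set x | exists2 a, A a & exists g : G, x = g * a * g^-1].

Section DehnQuandle.
Context (G : groupType) (A : set G).

(* The proof that A is non-empty is only used in the quandle structure. *)
Definition dehn_quandle of A !=set0 : Type := set_type (conjugates A).

Context (A0 : A !=set0).

Local Notation D := (dehn_quandle A0).

Definition dehn_val (x : D) : G := \val (x : set_type (conjugates A)).

Lemma dehn_val_inj : injective dehn_val.
Proof. exact: val_inj. Qed.

Lemma dehn_valP (x : D) : conjugates A (dehn_val x).
Proof. exact: set_valP. Qed.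

Lemma conjugatesJ (x y : G) : conjugates A x -> conjugates A (y * x * y^-1).
Proof.
by move=> [a Aa [g ->]]; exists a => //; exists (y * g); rewrite invgM !mulgA.
Qed.

Definition dehn_conj (y : G) (x : D) : D :=
  exist _ (y * dehn_val x * y^-1)
    (mem_set (conjugatesJ y (dehn_valP x))).

Definition dehn_op (x y : D) : D := dehn_conj (dehn_val y) x.

Lemma dehn_opE x y :
  dehn_val (dehn_op x y) = dehn_val y * dehn_val x * (dehn_val y)^-1.
Proof. by []. Qed.

Lemma dehn_inhabited : inhabited D.
Proof.
have [a Aa] := A0; split.
have Ca : conjugates A a by exists a => //; exists 1; rewrite mul1g invg1 mulg1.
exact: exist _ a (mem_set Ca).
Qed.

Lemma dehn_opxx x : dehn_op x x = x.
Proof. by apply: dehn_val_inj; rewrite dehn_opE mulgK. Qed.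

Lemma dehn_op_div x y : exists! z, x = dehn_op z y.
Proof.
exists (dehn_conj (dehn_val y)^-1 x); split=> [|z ->].
  by apply: dehn_val_inj; rewrite dehn_opE /dehn_val /= invgK !mulgA mulgV mul1g mulgK.
by apply: dehn_val_inj; rewrite /dehn_val /= invgK !mulgA mulVg mul1g mulgVK.
Qed.

Lemma dehn_opD x y z :
  dehn_op (dehn_op x y) z = dehn_op (dehn_op x z) (dehn_op y z).
Proof.
by apply: dehn_val_inj; rewrite !dehn_opE !invgM !invgK !mulgA !mulgVK.
Qed.

HB.instance Definition _ := isQuandle.Build D
  dehn_inhabited dehn_opxx dehn_op_div dehn_opD.

End DehnQuandle.

(* Main.v *)
Require Import Defs.
From HB Require Import structures.
From mathcomp Require Import all_boot.
From mathcomp Require Import monoid boolp classical_sets.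

(** Write D for the Dehn quandle of the conjugates of S in G = < S | R >.  The
    inclusion of D into G respects e_(x*y) = e_y e_x e_y^-1, which holds in G by
    the very definition of the operation, so it extends to a morphism
    phi : Env D -> G with phi e_x = x.

    The key fact ([env_conj]) is that Env D permutes its generators by
    conjugation exactly as G permutes D: g e_x g^-1 = e_y, with y the conjugate
    of x by phi g.  The defining relations say this for g a generator, and the
    property passes to inverses and products.

    It gives the inverse of phi, namely psi : G -> Env D sending s to e_s.  If
    w s w^-1 = t is a relation of G and w' is the value in Env D of the word w,
    then w' e_s w'^-1 is the generator attached to the element w s w^-1 = t of
    G, that is, e_t; so psi is well defined.  This is the only place where the
    shape of the relations matters.

    Now phi psi is the identity, as it fixes S.  Moreover psi is onto: every x
    in D has the form g s g^-1, and phi (psi g) = g, so the key fact gives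
    e_x = psi g e_s (psi g)^-1 = psi (g s g^-1).  Hence psi is bijective, and so
    is phi.  In the proof G and < S | R > are kept apart, and the identity is
    replaced with the given isomorphism f from the presented group to G. *)

Set Implicit Arguments.
Unset Strict Implicit.
Unset Printing Implicit Defensive.

Import Algebra.

Local Open Scope classical_set_scope.
Local Open Scope group_scope.

(** * Morphisms out of a presented group *)

Definition word_value (X : Type) (H : groupType) (f : X -> H) (w : word X) : H :=
  \prod_(a <- w) (if a.2 then (f a.1)^-1 else f a.1).

Section WordValue.
Context (X : Type) (H : groupType) (f : X -> H).

Lemma word_value_nil : word_value f [::] = 1.
Proof. exact: big_nil. Qed.

Lemma word_value_cons (a : X * bool) (w : word X) :
  word_value f (a :: w) = (if a.2 then (f a.1)^-1 else f a.1) * word_value f w.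
Proof. exact: big_cons. Qed.

Lemma word_value_cat (u v : word X) :
  word_value f (u ++ v) = word_value f u * word_value f v.
Proof. exact: big_cat. Qed.

Lemma word_value_letter (x : X) : word_value f (letter x) = f x.
Proof. exact: big_seq1. Qed.

Lemma word_value_inv (w : word X) : word_value f (winv w) = (word_value f w)^-1.
Proof.
elim: w => [|[x b] w IH]; first by rewrite word_value_nil invg1.
rewrite winv_cons word_value_cat IH !word_value_cons word_value_nil mulg1 /=.
by rewrite invgM; case: b; rewrite /= ?invgK.
Qed.

Lemma word_value_pres_eq (R : set (relation X)) :
  (forall u v, R (u, v) -> word_value f u = word_value f v) ->
  forall u v, pres_eq R u v -> word_value f u = word_value f v.
Proof.
move=> fR u v; elim=> {u v} //.
- move=> x b; rewrite !word_value_cons word_value_nil mulg1.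
  by case: b; rewrite /= ?mulVg ?mulgV.
- by move=> u u' v v' _ uu' _ vv'; rewrite !word_value_cat uu' vv'.
- by move=> u v w _ -> _ ->.
Qed.

(** von Dyck's theorem. *)
Lemma pres_group_lift (R : set (relation X)) :
  (forall u v, R (u, v) -> word_value f u = word_value f v) ->
  exists phi : UMagmaMorphism.type (pres_group R) H,
    forall x, phi (pres_gen R x) = f x.
Proof.
move=> fR.
pose phi (g : pres_group R) : H := word_value f (generic_quotient.repr g : word X).
have phiE w : phi (pres_class R w) = word_value f w.
  exact: word_value_pres_eq fR _ _ (repr_class R w).
have phi1 : phi 1 = 1 by rewrite -word_value_nil; exact: phiE.
have phiM : {morph phi : x y / x * y}.
  move=> g h; have [u ->] := pres_class_surj g.
  have [v ->] := pres_class_surj h.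
  transitivity (phi (pres_class R (u ++ v))).
    by congr phi; exact: pres_classM.
  by rewrite !phiE word_value_cat.
pose phi_mul := isMultiplicative.Build _ _ phi phiM.
pose phi_one := Multiplicative_isUMagmaMorphism.Build _ _ phi phi1.
pose phiH : UMagmaMorphism.type (pres_group R) H :=
  HB.pack phi phi_mul phi_one.
by exists phiH => x; rewrite -word_value_letter; exact: phiE.
Qed.

End WordValue.

Lemma gmulf_word_value (X : Type) (G H : groupType) (f : X -> G)
    (phi : UMagmaMorphism.type G H) (w : word X) :
  phi (word_value f w) = word_value (phi \o f) w.
Proof.
elim: w => [|[x b] w IH]; first by rewrite !word_value_nil gmulf1.
by rewrite !word_value_cons gmulfM IH; case: b; rewrite /= ?gmulfV.
Qed.

Section PresentedGroupTheory.
Context (X : Type) (R : set (relation X)).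

Lemma pres_class_word_value (w : word X) :
  pres_class R w = word_value (pres_gen R) w.
Proof.
elim: w => [|[x b] w IH]; first by rewrite word_value_nil.
rewrite word_value_cons -IH -cat1s -pres_classM /=; congr (_ * _).
case: b => //; apply/esym/mulg1_eq.
transitivity (pres_class R [:: (x, false); (x, true)]); first exact: pres_classM.
by apply/pres_classP; exact: pres_cancel.
Qed.

Lemma pres_group_ind (P : pres_group R -> Prop) :
  P 1 ->
  (forall x g, P g -> P (pres_gen R x * g)) ->
  (forall x g, P g -> P ((pres_gen R x)^-1 * g)) ->
  forall g, P g.
Proof.
move=> P1 PM PV g; have [w ->] := pres_class_surj g.
rewrite pres_class_word_value; elim: w => [|[x b] w IH].
  by rewrite word_value_nil.
by rewrite word_value_cons; case: b; [exact: PV | exact: PM].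
Qed.

Lemma pres_group_hom_ext (H : groupType)
    (phi psi : UMagmaMorphism.type (pres_group R) H) :
  (forall x, phi (pres_gen R x) = psi (pres_gen R x)) -> phi =1 psi.
Proof.
move=> eq_gen; elim/pres_group_ind => [|x g IH|x g IH].
- by rewrite !gmulf1.
- by rewrite !gmulfM eq_gen IH.
- by rewrite !gmulfM !gmulfV eq_gen IH.
Qed.

Lemma pres_gen_relation (u v : word X) :
  R (u, v) -> word_value (pres_gen R) u = word_value (pres_gen R) v.
Proof.
by move=> Ruv; rewrite -!pres_class_word_value; apply/pres_classP/pres_rel.
Qed.

End PresentedGroupTheory.

(** * The enveloping group of a Dehn quandle *)

Section DehnEnv.
Context (G : groupType) (A : set G) (A0 : A !=set0).

Local Notation D := (dehn_quandle A0).
Local Notation e := (pres_gen (@env_relations D)).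

Lemma env_gen_op (x y : D) : e (dehn_op x y) = e y * e x * (e y)^-1.
Proof.
have /pres_gen_relation : env_relations
    (letter (dehn_op x y), letter y ++ letter x ++ winv (letter y)).
  by exists x, y.
by rewrite !word_value_cat word_value_inv !word_value_letter mulgA.
Qed.

Lemma env_to_group :
  exists phi : UMagmaMorphism.type (Env D) G, forall x, phi (e x) = dehn_val x.
Proof.
apply: pres_group_lift => _ _ [x [y [-> ->]]].
by rewrite word_value_letter 2!word_value_cons word_value_inv word_value_letter mulgA.
Qed.

Context (phi : UMagmaMorphism.type (Env D) G).
Context (phi_gen : forall x, phi (e x) = dehn_val x).

(** Env D acts on its generators by conjugation through the action of G on D:
    the defining relations are the case of a generator g, and the case of an
    inverse generator follows because x is the quandle product by y of its
    conjugate by y^-1. *)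
Lemma env_conj (g : Env D) (x : D) : g * e x * g^-1 = e (dehn_conj (phi g) x).
Proof.
elim/pres_group_ind: g x => [|y g IH|y g IH] x.
- rewrite gmulf1 mul1g invg1 mulg1; congr e.
  by apply: dehn_val_inj; rewrite /dehn_val /= mul1g invg1 mulg1.
- rewrite invgM !mulgA -[e y * g * _]mulgA -[e y * _ * g^-1]mulgA IH.
  rewrite -env_gen_op; congr e; apply: dehn_val_inj.
  by rewrite dehn_opE /dehn_val /= gmulfM phi_gen invgM !mulgA.
- rewrite invgM invgK !mulgA -[_ * g * _]mulgA -[_ * _ * g^-1]mulgA IH.
  set z := dehn_conj (phi g) x.
  have -> : z = dehn_op (dehn_conj (phi ((e y)^-1 * g)) x) y.
    apply: dehn_val_inj; rewrite dehn_opE /z /dehn_val /= gmulfM gmulfV phi_gen.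
    by rewrite invgM invgK !mulgA mulgV mul1g mulgK.
  by rewrite env_gen_op !mulgA mulVg mul1g mulgVK.
Qed.

(** The form in which the key fact is used: an identity between conjugates in
    G lifts to Env D once the conjugating element does, and this holds both for
    the relations of G and for the elements of the quandle. *)
Lemma env_conj_gen (g : Env D) (x y : D) :
  phi g * dehn_val x * (phi g)^-1 = dehn_val y -> g * e x * g^-1 = e y.
Proof. by move=> xy; rewrite env_conj; congr e; exact: dehn_val_inj. Qed.

End DehnEnv.

Theorem theorem3p14 (G : groupType) (S : Type) (iota : S -> G)
    (R : set (relation S)) (S0 : range iota !=set0) :
  has_presentation iota R ->
  (forall r, R r -> conj_relation r) ->
  isomorphic (Env (dehn_quandle S0)) G.
Proof.
move=> [f [[finv fK finvK] f_gen]] Rconj.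
have [phi phi_gen] := env_to_group S0.
pose e := pres_gen (@env_relations (dehn_quandle S0)).
have iota_conj s : conjugates (range iota) (iota s).
  by exists (iota s); [exists s | exists 1; rewrite mul1g invg1 mulg1].
pose c s : dehn_quandle S0 := exist _ (iota s) (mem_set (iota_conj s)).
have phi_c w : phi (word_value (e \o c) w) = f (word_value (pres_gen R) w).
  rewrite !gmulf_word_value; congr (word_value _ w).
  by apply: funext => s /=; rewrite phi_gen f_gen.
have [psi psi_gen] : exists psi : UMagmaMorphism.type (pres_group R) (Env _),
    forall s, psi (pres_gen R s) = e (c s).
  apply: pres_group_lift => u v Ruv.
  have [w [s [t E]]] := Rconj _ Ruv.
  have uE : u = w ++ letter s ++ winv w := congr1 fst E.
  have vE : v = letter t := congr1 snd E.
  have := pres_gen_relation Ruv.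
  rewrite uE vE !word_value_cat !word_value_inv !word_value_letter => wst.
  rewrite mulgA; apply: (env_conj_gen phi_gen); rewrite phi_c.
  by rewrite /dehn_val /= -!f_gen -wst !gmulfM gmulfV mulgA.
have phi_psi p : phi (psi p) = f p.
  apply: (pres_group_hom_ext (phi := phi \o psi)) => s /=.
  by rewrite psi_gen phi_gen f_gen.
have env_gen x : exists p, psi p = e x.
  have [_ [s _ <-] [g xE]] := dehn_valP x.
  (* The image under psi of the element of < S | R > standing for g s g^-1. *)
  exists (finv g * pres_gen R s * (finv g)^-1).
  rewrite !gmulfM gmulfV psi_gen; apply: (env_conj_gen phi_gen).
  by rewrite phi_psi finvK xE.
have psi_surj h : exists p, psi p = h.
  elim/pres_group_ind: h => [|x _ [p <-]|x _ [p <-]].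
  - by exists 1; exact: gmulf1.
  - by have [q qE] := env_gen x; exists (q * p); rewrite gmulfM qE.
  - by have [q qE] := env_gen x; exists (q^-1 * p); rewrite gmulfM gmulfV qE.
exists phi, (psi \o finv) => [h|g] /=; last by rewrite phi_psi finvK.
by have [p <-] := psi_surj h; rewrite phi_psi fK.
Qed.
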